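(* Let $G$ be a finite nilpotent group. Then: (a) $G$ is almost Leinster if and only if $G$ is cyclic and $|G|$ is almost perfect; (b) $G$ is Leinster if and only if $G$ is cyclic and $|G|$ is perfect.
   Context: For a positive integer $n$ let $D(n)=\sum_{d\mid n} d$ be the sum of all positive divisors of $n$. The integer $n$ is perfect if $D(n)=2n$, and almost perfect if $D(n)=2n-1$. For a finite group $G$ let $D(G)=\sum_{N\trianglelefteq G}|N|$, the sum of the orders of all normal subgroups of $G$ (including the trivial subgroup and $G$ itself). The group $G$ is Leinster if $D(G)=2|G|$, and almost Leinster if $D(G)=2|G|-1$. *)

(* Defs.v *)
From mathcomp Require Import all_boot all_fingroup all_solvable.

Set Implicit Arguments.
Unset Strict Implicit.
Unset Printing Implicit Defensive.

Definition sum_divisors (n : nat) : nat := \sum_(d <- divisors n) d.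

(* [0 < n] excludes [n = 0], where [divisors] takes a default value; it also
   ensures that the truncated [2 * n - 1] is the integer one. *)
Definition perfect (n : nat) : Prop := 0 < n /\ sum_divisors n = 2 * n.

Definition almost_perfect (n : nat) : Prop :=
  0 < n /\ sum_divisors n = 2 * n - 1.

(* The sum ranges over [{group gT}], so each normal subgroup of [G] is counted
   exactly once, including [1%G] and [G]. *)
Definition sum_normal_orders (gT : finGroupType) (G : {group gT}) : nat :=
  \sum_(N : {group gT} | (N <| G)%g) #|N|.

Definition Leinster (gT : finGroupType) (G : {group gT}) : Prop :=
  sum_normal_orders G = 2 * #|G|.

Definition almost_Leinster (gT : finGroupType) (G : {group gT}) : Prop :=
  sum_normal_orders G = 2 * #|G| - 1.

(* Main.v *)
(** For cyclic [G], [N |-> #|N|] is a bijection from the normal subgroups of [G]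
    to the divisors of [#|G|].  A noncyclic nilpotent [G] has, for some prime
    [p], a quotient [G / N] that is elementary abelian of order [p ^ 2]; its
    [p + 1] subgroups of order [p] and itself have orders summing to more than
    [2 * p ^ 2], and pulling them back to [G] multiplies all orders by [#|N|], so
    the normal subgroup orders of [G] sum to more than [2 * #|G|]. *)
Require Import Defs.
From mathcomp Require Import all_boot all_fingroup all_solvable.

Lemma sum_normal_orders_cyclic {gT : finGroupType} {G : {group gT}} :
  cyclic G -> sum_normal_orders G = sum_divisors #|G|.
Proof.
move=> cycG; rewrite /sum_normal_orders /sum_divisors.
pose orders := [seq #|N| | N : {group gT} <- index_enum _ & (N <| G)%g].
transitivity (\sum_(d <- orders) d); first by rewrite big_map big_filter.
(* Both lists are duplicate-free, the first because a subgroup of a cyclic group is determined by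
   its order; it remains to compare their members. *)
apply: perm_big; apply: uniq_perm.
- rewrite map_inj_in_uniq ?filter_uniq ?index_enum_uniq // => N1 N2.
  rewrite !mem_filter => /andP[nN1 _] /andP[nN2 _] eqN.
  by apply/val_inj/eqP; rewrite (eq_subG_cyclic cycG) ?normal_sub ?eqN.
- exact: divisors_uniq.
move=> d; rewrite -dvdn_divisors ?cardG_gt0 //.
apply/mapP/idP => [[N] | dvd_d].
  by rewrite mem_filter => /andP[/normal_sub sNG _] ->; apply: cardSg.
have [x defG] := cyclicP cycG.
rewrite defG in dvd_d.
(* [cycle_sub_group] shows this set to be a singleton; only its nonemptiness is used. *)
have /set0Pn[N] : [set N : {group gT} | N \subset <[x]>%g & #|N| == d] != set0.
  by rewrite (cycle_sub_group dvd_d) -card_gt0 cards1.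
rewrite inE -defG => /andP[sNG /eqP oN]; exists N => //.
by rewrite mem_filter mem_index_enum andbT -sub_abelian_normal ?cyclic_abelian.
Qed.

Lemma leq_sum_normal_orders_quotient {gT : finGroupType} {G N : {group gT}} :
  (N <| G)%g ->
  #|N| * sum_normal_orders (G / N) <= sum_normal_orders G.
Proof.
move=> nsNG; rewrite /sum_normal_orders big_distrr /=.
under eq_bigr do rewrite -card_cosetpre.
pose f (L : {group coset_of N}) := (coset N @*^-1 L)%G.
have inj_f : injective f.
  move=> L1 L2 /(congr1 val) /= eqL; apply: val_inj => /=.
  by rewrite -(cosetpreK L1) eqL cosetpreK.
rewrite -(big_imset (fun M : {group gT} => #|M|) (h := f)
  (A := [pred L : {group coset_of N} | (L <| G / N)%g])) /=; last first.
  by move=> ? ? _ _ /inj_f.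
apply: (sub_le_big (le := leq) leqnn (fun m n => leq_addr n m)).
move=> M /imsetP[L /= nsL ->] /=.
by rewrite -(quotientGK nsNG) cosetpre_normal.
Qed.

(** The group analogue of an abundant number. The strict excess rules out both the Leinster and the
    almost Leinster equation, and it lifts from quotients. *)
Definition abundant_group {gT : finGroupType} (G : {group gT}) :=
  2 * #|G| < sum_normal_orders G.

Lemma abundant_group_quotient {gT : finGroupType} {G N : {group gT}} :
  (N <| G)%g -> abundant_group (G / N)%G -> abundant_group G.
Proof.
move=> nsNG abG; apply: leq_trans (leq_sum_normal_orders_quotient nsNG).
rewrite -(Lagrange (normal_sub nsNG)) -card_quotient ?normal_norm //.
by rewrite mulnCA ltn_pmul2l ?cardG_gt0.
Qed.

Lemma abundant_group_p2Elem (p : nat) {gT : finGroupType} {E : {group gT}} :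
  prime p -> p.-abelem%g E -> #|E| = p ^ 2 -> abundant_group E.
Proof.
move=> p_pr abE oE.
have E2 : E \in 'E_p^2(E)%g by rewrite pnElemE // !inE subxx abE oE eqxx.
(* [E] itself contributes [p ^ 2], so the proper subgroups must contribute more than [p ^ 2]; the
   [p + 1] lines give [(p + 1) * p]. *)
rewrite /abundant_group /sum_normal_orders (bigD1 E) ?normal_refl //=.
rewrite mul2n -addnn ltn_add2l.
have le_sum : \sum_(N in 'E_p^1(E)%g) #|N| <=
    \sum_(N : {group gT} | (N <| E)%g && (N != E)) #|N|.
  apply: (sub_le_big (le := leq) leqnn (fun m n => leq_addr n m)).
  move=> N; rewrite pnElemE // !inE => /andP[/andP[sNE _] /eqP oN].
  rewrite -sub_abelian_normal ?(abelem_abelian abE) // sNE /=.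
  apply/eqP => eqNE; move: oN; rewrite eqNE oE => /eqP.
  by rewrite eqn_exp2l ?prime_gt1.
apply: leq_trans le_sum; rewrite (eq_bigr (fun _ => p)); last first.
  by move=> N; rewrite pnElemE // !inE => /andP[_ /eqP ->].
by rewrite sum_nat_const (card_p1Elem_p2Elem E2) oE -mulnn ltn_pmul2r ?prime_gt0.
Qed.

(** The Frattini quotient of [P] is elementary abelian, and it has rank at least 2 because [P] is
    cyclic as soon as that quotient is. *)
Lemma abundant_group_pgroup (p : nat) {gT : finGroupType} {P : {group gT}} :
  prime p -> p.-group%g P -> ~~ cyclic P -> abundant_group P.
Proof.
move=> p_pr pP ncycP.
apply: (abundant_group_quotient (Phi_normal P)).
set Q := (P / 'Phi(P))%G.
have abQ : p.-abelem%g Q := Phi_quotient_abelem pP.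
have pQ := abelem_pgroup abQ.
have ncycQ : ~~ cyclic Q by apply: contra ncycP; apply: Phi_quotient_cyclic.
have lt1Q : 1 < logn p #|Q| by rewrite ltnNge -(abelem_cyclic abQ).
(* If [Q] has order [p ^ r], take [N] of order [p ^ (r - 2)], so that [Q / N] has order [p ^ 2];
   [lt1Q] makes the subtraction exact. *)
have [N [sNQ nsNQ oN]] :=
  normal_pgroup pQ (normal_refl Q) (leq_subr 2 (logn p #|Q|)).
apply: (abundant_group_quotient nsNQ).
apply: (abundant_group_p2Elem p) => //; first exact: quotient_abelem.
rewrite card_quotient ?normal_norm // -divgS // oN [X in X %/ _](card_pgroup pQ).
by rewrite -expnB ?prime_gt0 ?leq_subr // subKn.
Qed.

(** A nilpotent group with all Sylow subgroups cyclic is cyclic. By nilpotency each Sylow subgroup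
    is a direct factor, hence isomorphic to a quotient of [G], and a noncyclic one passes its
    abundance to [G]. *)
Lemma abundant_group_nilpotent {gT : finGroupType} {G : {group gT}} :
  nilpotent G -> ~~ cyclic G -> abundant_group G.
Proof.
move=> nilG; apply: contraR => nabG; apply: nil_Zgroup_cyclic => //.
apply/forall_inP => P /SylowP[p p_pr sylP].
rewrite (nilpotent_Hall_pcore nilG sylP).
have nsKG : ('O_p^'(G) <| G)%g := pcore_normal _ _.
have isoGK : ('O_p(G) \isog G / 'O_p^'(G))%g.
  have /dprodP[_ defG cGG tiGG] := nilpotent_pcoreC p nilG.
  rewrite -[X in _ \isog X / _]defG quotientMidr.
  apply: quotient_isog; last by rewrite setIC.
  exact: subset_trans (pcore_sub _ _) (normal_norm nsKG).
rewrite (isog_cyclic isoGK); apply: contraR nabG => ncyc.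
apply: (abundant_group_quotient nsKG).
apply: (abundant_group_pgroup p); rewrite //=.
by rewrite -(isog_pgroup _ isoGK) pcore_pgroup.
Qed.

Theorem corollary2p2 (gT : finGroupType) (G : {group gT}) (nilG : nilpotent G) :
  (almost_Leinster G <-> cyclic G /\ almost_perfect #|G|) /\
  (Leinster G <-> cyclic G /\ perfect #|G|).
Proof.
rewrite /almost_Leinster /Leinster /almost_perfect /perfect.
have [cycG | ncycG] := boolP (cyclic G).
  rewrite sum_normal_orders_cyclic // cardG_gt0.
  by split; split=> [|[_ []]].
have abG := abundant_group_nilpotent nilG ncycG.
(* Either equation would bound the sum by [2 * #|G|], against [abG]. *)
split; split=> [eqG | [] //]; move: abG; rewrite /abundant_group eqG.
  by rewrite ltnNge leq_subr.
by rewrite ltnn.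
Qed.
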